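(* Let $a=(a_i)_{i\in\mathbb Z}$ be any sequence of complex numbers and $\mu$ a Young diagram. For all $x=(x_1,x_2,\dots)$, $y=(y_1,y_2,\dots)$ with finitely many nonzero coordinates, $$s_{\mu;a}(x;y)=\sum_{\mathcal T}\prod_{k\ge1}f_{\mathcal T^{-1}(k);a}(x_k,y_k),$$ summed over all diagonal-strict tableaux $\mathcal T$ of shape $\mu$.
   Context: $\Lambda$ is the algebra of symmetric functions over $\mathbb C$ with complete homogeneous $h_k$, elementary $e_k$, power sums $\mathbf p_k$. For a sequence $a$ define $h_{k;a}=\sum_{i=1}^k(-1)^{k-i}e_{k-i}(a_1,\dots,a_{k-1})h_i$ ($k\ge1$), $h_{0;a}=1$, $h_{k;a}=0$ ($k<0$); $(\tau^ra)_i=a_{i+r}$; $s_{\mu;a}=\det[h_{\mu_i-i+j;\,\tau^{1-j}a}]_{i,j=1}^N$ for any $N\ge\ell(\mu)$. Each $f\in\Lambda$ is a function $f(x;y)$ via $\mathbf p_k\mapsto\sum_ix_i^k+(-1)^{k-1}\sum_jy_j^k$. Let $\mathbb Z'=\mathbb Z+\tfrac12$ and $a'_\varepsilon=a_{\varepsilon+1/2}$ for $\varepsilon\in\mathbb Z'$. The box $(i,j)$ (row $i$, column $j$) is the unit square $[i-1,i]\times[j-1,j]$ in coordinates where the first axis points down and the second to the right. For a skew hook $\nu$ (a connected skew diagram with no $2\times2$ block of boxes), an interior side is a unit segment shared by two boxes of $\nu$ (there are $|\nu|-1$ of them); write $s=(\varepsilon,\delta)$ for its midpoint; it is vertical if $\varepsilon\in\mathbb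 Z'$, $\delta\in\mathbb Z$ and horizontal if $\varepsilon\in\mathbb Z$, $\delta\in\mathbb Z'$; in both cases $\delta-\varepsilon\in\mathbb Z'$. Define $f_{\nu;a}(u,v)=(u+v)\prod_{\text{vertical }s=(\varepsilon,\delta)}(u-a'_{\delta-\varepsilon})\prod_{\text{horizontal }s=(\varepsilon,\delta)}(v+a'_{\delta-\varepsilon})$. For a skew diagram $\nu$ with no $2\times2$ block, $f_{\nu;a}$ is the product of the polynomials of its connected components (skew hooks), and $f_{\varnothing;a}=1$. A diagonal-strict tableau of shape $\mu$ is a map $\mathcal T$ from the boxes of $\mu$ to $\{1,2,\dots\}$ weakly increasing along each row (left to right) and down each column, and strictly increasing along each diagonal $j-i=\mathrm{const}$; each $\mathcal T^{-1}(k)$ is then a skew diagram with no $2\times 2$ block. *)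

(* Defs.v *)
From mathcomp Require Import all_boot all_order all_algebra.
From mathcomp Require Import reals complex.
Set Implicit Arguments. Unset Strict Implicit. Unset Printing Implicit Defensive.
Import Order.TTheory GRing.Theory Num.Theory.
Local Open Scope ring_scope.

Section Defs.
Variable F : fieldType.

(* image of the power sum p_r : sum_{i=1}^M x_i^r + (-1)^(r-1) sum_{j=1}^M y_j^r
   (x, y vanish beyond M in the theorem) *)
Definition psp (M : nat) (x y : nat -> F) (r : nat) : F :=
  \sum_(1 <= i < M.+1) x i ^+ r + (-1) ^+ r.-1 * \sum_(1 <= j < M.+1) y j ^+ r.

(* [h_0; ...; h_k] computed from the power sums by Newton's identities
   k h_k = sum_{r=1}^k p_r h_{k-r}  (valid in Lambda, hence in any image) *)
Fixpoint hseq (p : nat -> F) (k : nat) : seq F :=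
  match k with
  | 0 => [:: 1]
  | k'.+1 => let s := hseq p k' in
      rcons s ((k'.+1)%:R^-1 * \sum_(r < k'.+1) p r.+1 * nth 0 s (k' - r))
  end.

(* image of h_k under the ring morphism Lambda -> F with p_r |-> psp M x y r *)
Definition hsp (M : nat) (x y : nat -> F) (k : nat) : F :=
  nth 0 (hseq (psp M x y) k) k.

Definition esym (s : seq F) (k : nat) : F :=
  \sum_(I : {set 'I_(size s)} | #|I| == k) \prod_(i in I) s`_i.

Definition tau (r : int) (a : int -> F) : int -> F := fun i => a (i + r).

(* h_{k;a}, given the images hh i of h_i *)
Definition hka (a : int -> F) (hh : nat -> F) (k : int) : F :=
  match k with
  | Posz n => if n == 0%N then 1 else
      \sum_(1 <= i < n.+1)
        (-1) ^+ (n - i) * esym [seq a (Posz t) | t <- iota 1 n.-1] (n - i) * hh i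
  | Negz _ => 0
  end.

(* s_{mu;a} = det[h_{mu_i - i + j; tau^{1-j} a}]_{i,j=1}^{l(mu)}, with the h's
   specialized through hh (0-indexed i,j below) *)
Definition schur (a : int -> F) (mu : seq nat) (hh : nat -> F) : F :=
  \det (\matrix_(i < size mu, j < size mu)
          hka (tau (- (j : int)) a) hh
              ((nth 0%N mu i)%:Z - (i.+1)%:Z + (j.+1)%:Z)).

(* a box (i,j) : 'I_K * 'I_K is the paper's box (i+1, j+1) *)
Variable K : nat.
Notation box := ('I_K * 'I_K)%type.

Definition inshape (mu : seq nat) (b : box) : bool :=
  (b.1 < size mu)%N && (b.2 < nth 0%N mu b.1)%N.

Definition adjb (b b' : box) : bool :=
  ((b.1 == b'.1 :> nat) && ((b.2.+1 == b'.2 :> nat) || (b'.2.+1 == b.2 :> nat)))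
  || ((b.2 == b'.2 :> nat) && ((b.1.+1 == b'.1 :> nat) || (b'.1.+1 == b.1 :> nat))).

Definition adj (C : {set box}) : rel box :=
  fun b b' => [&& b \in C, b' \in C & adjb b b'].

Definition comps (C : {set box}) : {set {set box}} :=
  [set [set b' in C | connect (adj C) b b'] | b in C].

(* polynomial of a skew hook C: (u+v) times a factor per interior side.
   Vertical side between (i,j) and (i,j+1) (0-indexed): midpoint
   (eps,delta) = (i+1/2, j+1), a'_{delta-eps} = a_{j-i+1}.
   Horizontal side between (i,j) and (i+1,j): midpoint (i+1, j+1/2),
   a'_{delta-eps} = a_{j-i}. *)
Definition fhook (a : int -> F) (C : {set box}) (u v : F) : F :=
  (u + v)
  * \prod_(p : box * box | [&& p.1 \in C, p.2 \in C,
                               p.1.1 == p.2.1 :> nat & p.1.2.+1 == p.2.2 :> nat])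
      (u - a ((p.1.2 : int) - (p.1.1 : int) + 1))
  * \prod_(p : box * box | [&& p.1 \in C, p.2 \in C,
                               p.1.1.+1 == p.2.1 :> nat & p.1.2 == p.2.2 :> nat])
      (v + a ((p.1.2 : int) - (p.1.1 : int))).

Definition fdiag (a : int -> F) (nu : {set box}) (u v : F) : F :=
  \prod_(D in comps nu) fhook a D u v.

(* Diagonal-strict tableaux of shape mu with entries in {1,...,M}, encoded as
   T : box -> 'I_M.+1 with value 0 exactly outside the shape. *)
Definition dstab (mu : seq nat) (M : nat) (T : {ffun box -> 'I_M.+1}) : bool :=
  [forall b, (val (T b) != 0%N) == inshape mu b] &&
  [forall b, forall b', (inshape mu b && inshape mu b') ==>
     [&& ((b.1 == b'.1) && (b.2 <= b'.2)%N) ==> (T b <= T b')%N,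
         ((b.2 == b'.2) && (b.1 <= b'.1)%N) ==> (T b <= T b')%N &
         (((b.2 : int) - (b.1 : int) == (b'.2 : int) - (b'.1 : int))
            && (b.1 < b'.1)%N) ==> (T b < T b')%N]].

End Defs.

(* Main.v *)
Require Import Defs.
From mathcomp Require Import all_boot all_order all_algebra.
From mathcomp Require Import fingroup perm reals complex zify ring.
Set Implicit Arguments. Unset Strict Implicit. Unset Printing Implicit Defensive.
Import Order.TTheory GRing.Theory Num.Theory.
Local Open Scope ring_scope.

(** Both sides satisfy the same branching rule when one pair of variables (u, v)
is added. For k >= 1, h_(k;a) is the value of the linear functional z^i |-> h_(i+1)
on (z - a_1) ... (z - a_(k-1)); since the new pair multiplies the generating
series of the h_k by (1 + v t) / (1 - u t), this yields
h_(k;a) = sum_i h_(i;a) (u + v) (u - a_(i+1)) ... (u - a_(k-1)) + h_(k;a),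
with the old h on the right. Applied to every entry of the determinant
s_(mu;a), it factors the matrix, and Cauchy-Binet gives a sum over la of s_(la;a)
times a determinant indexed by the pair (mu, la). Peeling off rows shows
that this determinant vanishes unless la is contained in mu and mu/la has no 2x2
block, and is otherwise a product over the rows of mu/la, namely f_(mu/la;a)(u, v).
On the other side, removing the largest entry from the diagonal-strict
tableaux of shape mu gives the same recursion.

Partitions with at most N rows are functions la on the row index, encoded by
the strictly decreasing numbers la_i + N - i, i = 0, ..., N - 1. *)

(** * Adding a pair of variables to the complete functions *)

Section Newton.
Variable F : fieldType.
Hypothesis F0 : [pchar F] =i pred0.
Implicit Types (u v w p h : nat -> F).

Definition conv u v k := \sum_(i < k.+1) u i * v (k - i)%N.

(** Coefficient [k] does not see a truncation at degree [n], so commutativity and associativity of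
    the product of power series are inherited from [{poly F}]. *)
Lemma conv_poly u v n k : (k < n)%N ->
  conv u v k = (\poly_(i < n) u i * \poly_(i < n) v i)`_k.
Proof.
move=> kn; rewrite coefM; apply: eq_bigr => i _; rewrite !coef_poly.
have ik := ltn_ord i.
by rewrite (leq_ltn_trans _ kn) ?(leq_ltn_trans (leq_subr _ _) kn) // -ltnS.
Qed.

Lemma convC u v k : conv u v k = conv v u k.
Proof. by rewrite !(@conv_poly _ _ k.+1) // mulrC. Qed.

Lemma convA u v w k : conv u (conv v w) k = conv (conv u v) w k.
Proof.
rewrite /conv.
transitivity ((\poly_(i < k.+1) u i * (\poly_(i < k.+1) v i * \poly_(i < k.+1) w i))`_k).
  rewrite coefM; apply: eq_bigr => i _; rewrite coef_poly ltn_ord.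
  by rewrite -conv_poly // ltnS leq_subr.
rewrite mulrA coefM; apply: eq_bigr => i _.
by rewrite -conv_poly // coef_poly ltnS leq_subr.
Qed.

Lemma eq_conv u u' v v' : u =1 u' -> v =1 v' -> conv u v =1 conv u' v'.
Proof. by move=> eu ev k; apply: eq_bigr => i _; rewrite eu ev. Qed.

Lemma convDl u u' v k : conv (fun i => u i + u' i) v k = conv u v k + conv u' v k.
Proof. by rewrite /conv -big_split; apply: eq_bigr => i _; rewrite mulrDl. Qed.

(** Newton's identities as t H' = P H, where H and P are the generating series of [h] and [p]. *)
Definition newton p h := forall k, k%:R * h k = conv p h k.

(** Leibniz rule: t (H G)' = (P + Q) H G. The factor k splits as i + (k - i) in each term of the
    product. *)
Lemma newton_conv p q h g :
  newton p h -> newton q g -> newton (fun i => p i + q i) (conv h g).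
Proof.
move=> ph qg k; rewrite convDl.
rewrite convA -(eq_conv ph (frefl g)).
rewrite (eq_conv (frefl q) (convC h g)) convA -(eq_conv qg (frefl h)) (convC _ h).
rewrite /conv mulr_sumr -big_split; apply: eq_bigr => i _ /=.
have ik : (i <= k)%N by rewrite -ltnS.
by rewrite -{1}(subnKC ik) natrD; ring.
Qed.

(** As [p 0] vanishes, the right side at index k involves only smaller indices of the solution, and
    k is invertible in characteristic 0. *)
Lemma newton_uniq p h g : p 0%N = 0 -> newton p h -> newton p g ->
  h 0%N = g 0%N -> h =1 g.
Proof.
move=> p0 ph pg e0; elim/ltn_ind => -[|k] IH //.
have k0 : k.+1%:R != 0 :> F by rewrite ((pcharf0P F).1 F0).
apply: (mulfI k0); rewrite ph pg /conv big_ord_recl [RHS]big_ord_recl /= p0 !mul0r !add0r.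
by apply: eq_bigr => i _; rewrite IH // subSS ltnS leq_subr.
Qed.

Definition lin (c : F) k : F := nth 0 [:: 1; c] k.

(** Coefficients of c t / (1 + c t), which is t times the logarithmic derivative of 1 + c t. *)
Definition linp (c : F) k : F := if k is 0 then 0 else - (- c) ^+ k.

Lemma conv_lin h c k : conv (lin c) h k.+1 = h k.+1 + c * h k.
Proof.
rewrite /conv !big_ord_recl /= /lin /= big1 ?addr0 ?mul1r ?subn1 //.
by move=> i _; rewrite /bump /= nth_nil mul0r.
Qed.

Lemma newton_lin c : newton (linp c) (lin c).
Proof.
case=> [|[|k]]; rewrite (convC (linp c)) ?conv_lin.
- by rewrite /conv big_ord1 mul0r mulr0.
- by rewrite /lin /linp /=; ring.
by rewrite /lin /linp /= nth_nil exprS; ring.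
Qed.

Lemma size_hseq p k : size (hseq p k) = k.+1.
Proof. by elim: k => //= k IH; rewrite size_rcons IH. Qed.

Lemma nth_hseq p k i : (i <= k)%N -> nth 0 (hseq p k) i = nth 0 (hseq p i) i.
Proof.
elim: k => [|k IH]; first by rewrite leqn0 => /eqP ->.
rewrite leq_eqVlt => /predU1P[-> //|ik].
by rewrite /= nth_rcons size_hseq ik IH.
Qed.

(** The recursion of [hseq] reads only positive indices; at index 0 the value of [psp], which is 2M,
    is replaced by the 0 that [newton_uniq] asks for. *)
Lemma newton_hsp M x y :
  newton (fun r => if r is 0 then 0 else psp M x y r) (hsp M x y).
Proof.
case=> [|k]; first by rewrite /conv big_ord1 !mul0r.
have k0 : k.+1%:R != 0 :> F by rewrite ((pcharf0P F).1 F0).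
rewrite {1}/hsp /= nth_rcons size_hseq ltnn eqxx mulrA divff // mul1r.
rewrite /conv [RHS]big_ord_recl mul0r add0r; apply: eq_bigr => i _ /=.
by rewrite subSS nth_hseq // leq_subr.
Qed.

(** In series, (1 - x t) H_{M+1} = (1 + y t) H_M for the new pair x, y: both sides solve Newton's
    identities with the same power sums. *)
Lemma hspS M (x y : nat -> F) k :
  hsp M.+1 x y k.+1
  = x M.+1 * hsp M.+1 x y k + hsp M x y k.+1 + y M.+1 * hsp M x y k.
Proof.
have := @newton_uniq _ (conv (lin (- x M.+1)) (hsp M.+1 x y))
  (conv (lin (y M.+1)) (hsp M x y)) _ (newton_conv (newton_lin _) (newton_hsp _ _ _)) _ _ k.+1.
rewrite !conv_lin => E.
rewrite -addrA -E /=; first by ring.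
- by rewrite addr0.
- move=> j; rewrite (newton_conv (newton_lin _) (newton_hsp _ _ _)).
  apply: eq_conv => // -[|r] //=; rewrite /psp !(big_nat_recr M.+1) //= opprK.
  by rewrite [(- y _) ^+ _]exprNn [(-1) ^+ r.+1]exprS; set e := (-1) ^+ r; ring.
- by rewrite /conv !big_ord1 /hsp /= !mulr1.
Qed.

End Newton.

Local Arguments hka : simpl never.

(** * Factorial complete functions through a linear functional *)

Section UmbralFunctional.
Variable F : fieldType.
Implicit Types (h : nat -> F) (p : {poly F}) (b : int -> F).

Definition umbral h p := \sum_(i < size p) p`_i * h i.+1.

Lemma umbralE h p n : (size p <= n)%N -> umbral h p = \sum_(i < n) p`_i * h i.+1.
Proof.
move=> pn; rewrite /umbral (big_ord_widen n (fun i => p`_i * h i.+1)) //.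
rewrite big_mkcond; apply: eq_bigr => i _; case: ltnP => // le_pi.
by rewrite nth_default // mul0r.
Qed.

Lemma umbralD h p q : umbral h (p + q) = umbral h p + umbral h q.
Proof.
have sD := size_polyD p q.
rewrite !(@umbralE _ _ (maxn (size p) (size q))) ?leq_maxl ?leq_maxr //.
by rewrite -big_split; apply: eq_bigr => i _; rewrite coefD mulrDl.
Qed.

Lemma umbralZ h c p : umbral h (c *: p) = c * umbral h p.
Proof.
rewrite (@umbralE _ _ _ (size_scale_leq c p)) mulr_sumr.
by apply: eq_bigr => i _; rewrite coefZ mulrA.
Qed.

Lemma umbral_sum h (I : finType) (f : I -> {poly F}) :
  umbral h (\sum_i f i) = \sum_i umbral h (f i).
Proof.
apply: (big_morph _ (@umbralD h)).
by rewrite /umbral size_poly0 big_ord0.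
Qed.

Lemma umbralXn h n : umbral h 'X^n = h n.+1.
Proof.
rewrite /umbral size_polyXn big_ord_recr /= big1 ?add0r ?coefXn ?eqxx ?mul1r //.
by move=> i _; rewrite coefXn (ltn_eqF (ltn_ord i)) mul0r.
Qed.

Lemma umbral1 h : umbral h 1 = h 1%N.
Proof. by rewrite -(expr0 'X) umbralXn. Qed.

Lemma umbralMX h p : umbral h (p * 'X) = umbral (h \o S) p.
Proof.
rewrite (@umbralE _ _ (size p).+1).
  by rewrite big_ord_recl coefMX mul0r add0r; apply: eq_bigr => i _; rewrite coefMX.
by apply: leq_trans (size_polyMleq _ _) _; rewrite size_polyX addn2.
Qed.

Lemma umbralMXsubC h p c :
  umbral h (p * ('X - c%:P)) = umbral (h \o S) p - c * umbral h p.
Proof.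
by rewrite mulrBr umbralD umbralMX mulrC mul_polyC -scaleNr umbralZ mulNr.
Qed.

Definition fallpoly b n : {poly F} := \prod_(1 <= t < n.+1) ('X - (b (Posz t))%:P).

Lemma fallpolyS b n : fallpoly b n.+1 = fallpoly b n * ('X - (b (Posz n.+1))%:P).
Proof. by rewrite /fallpoly big_nat_recr. Qed.

Lemma hka0 b h : hka b h (Posz 0) = 1.
Proof. by []. Qed.

(** Vieta: the product expands over the subsets of factors from which the root is taken; those of
    size i contribute (-1)^i e_i times ['X^(n - i)]. *)
Lemma hka_umbral b h n : hka b h (Posz n.+1) = umbral h (fallpoly b n).
Proof.
rewrite /hka /=; set s := [seq _ | _ <- _].
have ss : size s = n by rewrite size_map size_iota.
have -> : fallpoly b n = \prod_(i < size s) (- (s`_i)%:P + 'X).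
  rewrite /fallpoly big_add1 /= big_mkord ss; apply: eq_bigr => i _.
  by rewrite addrC (nth_map 0%N) ?size_iota // nth_iota // add1n.
rewrite bigA_distr umbral_sum.
have -> : \sum_(1 <= i < n.+2) (-1) ^+ (n.+1 - i) * Defs.esym s (n.+1 - i) * h i =
   \sum_(i < n.+1) (-1) ^+ i * Defs.esym s i * h (n.+1 - i)%N.
  rewrite big_add1 /= big_mkord (reindex_inj rev_ord_inj) /=.
  apply: eq_bigr => i _; have := ltn_ord i => lt_i.
  have -> : (n.+1 - (n.+1 - i.+1).+1 = i)%N by lia.
  by have -> : ((n.+1 - i.+1).+1 = n.+1 - i)%N by lia.
have cJ (J : {set 'I_(size s)}) : (#|J| < n.+1)%N.
  by rewrite ltnS; apply: leq_trans (max_card _) _; rewrite card_ord ss.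
rewrite [RHS](partition_big (fun J => Ordinal (cJ J)) xpredT) //=.
apply: eq_bigr => i _; rewrite /Defs.esym mulr_sumr mulr_suml.
apply: eq_big => [//|J /eqP <-].
have -> : \prod_i (if i \in J then - (s`_i)%:P else 'X) =
          ((-1) ^+ #|J| * \prod_(k in J) s`_k) *: 'X^(n - #|J|) :> {poly F}.
  rewrite (bigID (mem J)) /=.
  rewrite (eq_bigr (fun i : 'I_(size s) => (- s`_i)%:P)); last by move=> k ->; rewrite polyCN.
  rewrite [X in _ * X](eq_bigr (fun _ : 'I_(size s) => 'X)); last by move=> k /negPf ->.
  rewrite -rmorph_prod /= mul_polyC prodrN; congr (_ *: _).
  rewrite prodr_const; congr (_ ^+ _).
  by rewrite -(etrans (cardC J) (etrans (card_ord _) ss)) addKn.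
by rewrite umbralZ umbralXn -subSn // -ltnS.
Qed.

Section AddVariable.
Variables (h h' : nat -> F) (x y : F).
Hypothesis h0 : h 0%N = 1.
Hypothesis h0' : h' 0%N = 1.
Hypothesis hh' : forall k, h' k.+1 = x * h' k + h k.+1 + y * h k.

(** Multiplying by z - x turns the functional of [h'] into that of h'_{k+1} - x h'_k, which equals
    h_{k+1} + y h_k. *)
Lemma umbral_add_var p :
  umbral h' (p * ('X - x%:P)) = umbral h (p * ('X - x%:P)) + (x + y) * umbral h p.
Proof.
rewrite !umbralMXsubC /umbral !mulr_sumr -!sumrB -big_split.
by apply: eq_bigr => i _ /=; rewrite hh'; ring.
Qed.

Lemma hka_coproduct b n :
  hka b h' (Posz n) = \sum_(i < n) ((x + y) * \prod_(i.+1 <= t < n) (x - b (Posz t)))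
      * hka b h (Posz i) + hka b h (Posz n).
Proof.
case: n => [|n]; first by rewrite big_ord0 add0r.
rewrite hka_umbral; elim: n => [|n IH].
  rewrite big_ord1 big_geq // hka_umbral /fallpoly big_geq // !umbral1 hh' h0 h0' hka0.
  by ring.
rewrite fallpolyS.
(* The last root is traded for x, where [umbral_add_var] applies; the error is x - c times the
   functional at the shorter product, which induction handles. *)
have change_root g p c :
    umbral g (p * ('X - c%:P)) = umbral g (p * ('X - x%:P)) + (x - c) * umbral g p.
  by rewrite !umbralMXsubC; ring.
rewrite change_root umbral_add_var IH.
rewrite [in RHS]big_ord_recr /= big_geq // mulr1 -hka_umbral.
rewrite [hka b h n.+2]hka_umbral fallpolyS (change_root _ _ (b n.+1)) -hka_umbral.
rewrite [X in _ = X + _ + _](eq_bigr (fun i : 'I_n.+1 => (x - b n.+1) *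
  ((x + y) * \prod_(i.+1 <= t < n.+1) (x - b t) * hka b h i))); last first.
  by move=> i _; rewrite big_nat_recr //=; ring.
rewrite -mulr_sumr.
by ring.
Qed.

End AddVariable.
End UmbralFunctional.

(** * The Cauchy-Binet formula *)

Section CauchyBinet.
Variables (R : comPzRingType) (n m : nat).
Implicit Types (f : {ffun 'I_n -> 'I_m}) (s : {perm 'I_n}).

Definition decr f := [forall i : 'I_n, forall j : 'I_n, (i < j)%N ==> (f j < f i)%N].

Lemma decrP f : reflect (forall i j : 'I_n, (i < j)%N -> (f j < f i)%N) (decr f).
Proof.
apply: (iffP forallP) => [H i j ij|H i]; first exact: implyP (forallP (H i) j) ij.
by apply/forallP => j; apply/implyP/H.
Qed.

Lemma decr_inj f : decr f -> injective f.
Proof.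
move=> /decrP df i j eij; apply: val_inj => /=.
by case: (ltngtP i j) => // /df; rewrite eij ltnn.
Qed.

Definition fcomp s f : {ffun 'I_n -> 'I_m} := [ffun i => f (s i)].

Lemma fcompK s : cancel (fcomp s) (fcomp s^-1%g).
Proof. by move=> f; apply/ffunP => i; rewrite !ffunE permKV. Qed.

Lemma fcompKV s : cancel (fcomp s^-1%g) (fcomp s).
Proof. by move=> f; apply/ffunP => i; rewrite !ffunE permK. Qed.

(** For injective [f], the position of [f i] in the decreasing order of the values. *)
Definition rank_of f (i : 'I_n) := #|[set j | (f i < f j)%N]|.

Lemma rank_of_lt f i : (rank_of f i < n)%N.
Proof.
have cT : #|[set: 'I_n]| = n by rewrite cardsT card_ord.
apply: leq_trans (_ : #|[set: 'I_n]| <= n)%N; last by rewrite cT.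
apply: proper_card; apply/properP; split=> //.
by exists i; rewrite ?inE // ltnn.
Qed.

Definition rank_ord f i := Ordinal (rank_of_lt f i).

Lemma rank_of_le f i j : (f i <= f j)%N -> (rank_of f j <= rank_of f i)%N.
Proof.
by move=> le_ij; apply/subset_leq_card/subsetP => k; rewrite !inE; apply: leq_ltn_trans.
Qed.

Lemma rank_of_ltn f i j : (f i < f j)%N -> (rank_of f j < rank_of f i)%N.
Proof.
move=> lt_ij; apply/proper_card/properP; split; last by exists j; rewrite !inE ?ltnn.
by apply/subsetP => k; rewrite !inE; apply: ltn_trans.
Qed.

Lemma rank_inj f : injective f -> injective (rank_ord f).
Proof.
move=> fi i j /(congr1 val) /= eij; apply/fi/val_inj.
by case: (ltngtP (f i) (f j)) => // /rank_of_ltn; rewrite eij ltnn.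
Qed.

Lemma rank_decr f s k : decr (fcomp s f) -> rank_of f (s k) = k.
Proof.
move=> /decrP df; rewrite /rank_of -(card_imset _ (@perm_inj _ s^-1%g)).
rewrite -[RHS](_ : #|[set j : 'I_n | (j < k)%N]| = k); last first.
  rewrite cardsE -sum1_card (big_ord_narrow (ltnW (ltn_ord k))) /=.
  by rewrite sum1_card card_ord.
apply: eq_card => j; rewrite inE -[j in LHS](permK s) mem_imset ?inE; last exact: perm_inj.
case: (ltngtP j k) => [jk|kj|/val_inj ->]; last by rewrite ltnn.
  by have := df _ _ jk; rewrite !ffunE.
by have := df _ _ kj; rewrite !ffunE ltnNge => /negP h; apply/negP => /ltnW.
Qed.

(** A sorting permutation must send k to the index of rank k, so it is the inverse of the rank
    permutation. *)
Lemma sorting_perm f : injective f -> exists s0, (fun s => decr (fcomp s f)) =1 pred1 s0.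
Proof.
move=> fi; pose r := perm (rank_inj fi); exists r^-1%g => s /=; apply/idP/eqP => [df|->].
  apply/permP => k; apply: (@perm_inj _ r); rewrite permKV permE.
  by apply: val_inj; rewrite /= rank_decr.
apply/decrP => i j ij; rewrite !ffunE ltnNge; apply/negP => /rank_of_le.
have rE k : rank_of f (r^-1%g k) = k 
  by have /(congr1 val) := permKV r k; rewrite [r _]permE.
by rewrite !rE leqNgt ij.
Qed.

(** The determinant expands over all maps [f]. Maps that are not injective give equal rows of B and
    drop out; the others are grouped by their decreasing rearrangement. *)
Lemma Cauchy_Binet (A : 'M[R]_(n, m)) (B : 'M[R]_(m, n)) :
  \det (A *m B) = \sum_(f | decr f)
     \det (\matrix_(i, j) A i (f j)) * \det (\matrix_(i, j) B (f i) j).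
Proof.
pose G f := (\prod_i A i (f i)) * \det (\matrix_(i, j) B (f i) j).
have detE : \det (A *m B) = \sum_f G f.
  rewrite /G; under [RHS]eq_bigr => f _ do rewrite mulr_sumr.
  rewrite exchange_big /=; apply: eq_bigr => s _.
  under eq_bigr => i _ do rewrite mxE.
  rewrite bigA_distr_bigA mulr_sumr /=; apply: eq_bigr => f _.
  rewrite big_split mulrCA; congr (_ * (_ * _)).
  by apply: eq_bigr => i _; rewrite mxE.
have -> : \det (A *m B) = \sum_(f : {ffun 'I_n -> 'I_m} | injectiveb f) G f.
  rewrite detE [RHS]big_mkcond; apply: eq_bigr => f _; case: ifPn => // /injectivePn.
  case=> i [j ij fij]; rewrite /G (determinant_alternate ij) ?mulr0 // => k.
  by rewrite !mxE fij.
transitivity (\sum_(s : {perm 'I_n}) \sum_(f | decr (fcomp s f)) G f).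
  rewrite (exchange_big_dep (fun f : {ffun 'I_n -> 'I_m} => injectiveb f)) /=.
    apply: eq_bigr => f /injectiveP /sorting_perm[s0 E].
    by rewrite (eq_bigl _ _ E) big_pred1_eq.
  move=> s f _ /decr_inj fi; apply/injectiveP => i j eij; apply: (@perm_inj _ s^-1%g).
  by apply: fi; rewrite !ffunE !permKV.
transitivity (\sum_(s : {perm 'I_n}) \sum_(f | decr f) G (fcomp s^-1%g f)).
  apply: eq_bigr => s _.
  rewrite (reindex_onto (fcomp s^-1%g) (fcomp s)) => [|f _]; last exact: fcompK.
  by apply: eq_bigl => f; rewrite fcompKV eqxx andbT.
rewrite exchange_big /=; apply: eq_bigr => f _.
rewrite {1}/determinant mulr_suml (reindex_inj invg_inj); apply: eq_bigr => s _.
rewrite /G invgK.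
(* Sorting the rows of B produces the sign that completes the sum over [s] to a minor of A. *)
have -> : \matrix_(i, j) B (fcomp s f i) j = row_perm s (\matrix_(i, j) B (f i) j).
  by apply/matrixP => i j; rewrite !mxE ffunE.
rewrite row_permE det_mulmx det_perm mulrCA mulrA; congr (_ * _ * _).
by apply: eq_bigr => i _; rewrite mxE ffunE.
Qed.
End CauchyBinet.

(** * The branching determinant *)

Section HookDeterminant.
Variables (R : comPzRingType) (x y : R) (al : nat -> R).

(** The coefficients of [hka_coproduct], with both indices and the parameters shifted to
    beta-numbers. *)
Definition gen P Q : R :=
  if (P < Q)%N then 0 else if P == Q then 1
  else (x + y) * \prod_(Q.+1 <= t < P) (x - al t).

(* Factor of row i of mu/la, where P, Q and P2 encode mu_i, la_i and mu_(i+1): the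
   two rows i and i+1 share a side iff P2 = Q. *)
Definition wt P Q P2 : R :=
  if (P < Q)%N || (Q < P2)%N then 0
  else if P2 == Q then (y + al Q) * \prod_(Q.+1 <= t < P) (x - al t)
  else gen P Q.

Lemma gen_lt P Q : (P < Q)%N -> gen P Q = 0.
Proof. by rewrite /gen => ->. Qed.

Lemma gen_gt P Q : (Q < P)%N -> gen P Q = (x + y) * \prod_(Q.+1 <= t < P) (x - al t).
Proof. by rewrite /gen => QP; rewrite ltnNge ltnW //= gtn_eqF. Qed.

(** The ratio of the two rows does not depend on Q, which is what makes row operations effective. *)
Lemma gen_split P P2 Q : (Q < P2)%N -> (P2 <= P)%N ->
  gen P Q = \prod_(P2 <= t < P) (x - al t) * gen P2 Q.
Proof.
move=> QP2 P2P; rewrite !gen_gt ?(leq_trans QP2) // (big_cat_nat QP2 P2P) /=; ring.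
Qed.

Lemma det_row_op n (A : 'M[R]_n) (i0 i1 : 'I_n) (c : R) : i1 != i0 ->
  \det A = \det (\matrix_(i, j) (if i == i0 then A i j - c * A i1 j else A i j)).
Proof.
move=> i10; set A' := (X in _ = \det X).
have := @determinant_multilinear _ _ A' A
  (\matrix_(i, j) A (if i == i0 then i1 else i) j) i0 1 (- c) _ _ _.
move=> ->; last 3 first.
- by apply/rowP => j; rewrite !mxE eqxx mul1r mulNr.
- by apply/matrixP => i j; rewrite !mxE eq_sym (negPf (neq_lift _ _)).
- by apply/matrixP => i j; rewrite !mxE eq_sym (negPf (neq_lift _ _)).
rewrite mul1r [X in - c * X](determinant_alternate i10) ?mulr0 ?addr0 // => j.
by rewrite !mxE eqxx (negPf i10).
Qed.

(** Induction on the number of rows. [B N] is a sentinel below every [C i], standing for the empty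
    row after the last one. *)
Lemma det_gen N (B C : nat -> nat) :
  (forall i, (i < N)%N -> (B i.+1 < B i)%N) ->
  (forall i, (i.+1 < N)%N -> (C i.+1 < C i)%N) ->
  (forall i, (i < N)%N -> (B N < C i)%N) ->
  \det (\matrix_(i < N, j < N) gen (B i) (C j)) = \prod_(i < N) wt (B i) (C i) (B i.+1).
Proof.
elim: N B C => [|N IH] B C dB dC BC; first by rewrite det_mx00 big_ord0.
rewrite big_ord_recl /=.
have Ble i j : (i <= j <= N.+1)%N -> (B j <= B i)%N.
  elim: j => [|j IHj]; first by rewrite leqn0 => /andP[/eqP->].
  case/andP; rewrite leq_eqVlt => /predU1P[-> //|ij] jN.
  by apply: leq_trans (ltnW (dB _ jN)) _; apply: IHj; rewrite -ltnS ij ltnW.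
have Cle i j : (i <= j < N.+1)%N -> (C j <= C i)%N.
  elim: j => [|j IHj]; first by rewrite leqn0 => /andP[/eqP->].
  case/andP; rewrite leq_eqVlt => /predU1P[-> //|ij] jN.
  by apply: leq_trans (ltnW (dC _ jN)) _; apply: IHj; rewrite -ltnS ij ltnW.
have {}IH : \det (\matrix_(i < N, j < N) gen (B i.+1) (C j.+1))
    = \prod_(i < N) wt (B (lift ord0 i)) (C (lift ord0 i)) (B (lift ord0 i).+1).
  by apply: (IH (B \o S) (C \o S)) => i iN /=; [exact: dB|exact: dC|exact: BC].
(* If [B 0 < C 0], the first column vanishes. *)
rewrite /wt; case: ltnP => [BC0|CB0] /=.
  rewrite (expand_det_col _ ord0) big1 ?mul0r // => i _.
  rewrite mxE gen_lt ?mul0r //; apply: leq_ltn_trans BC0.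
  by apply: Ble; rewrite leq0n ltnW.
(* If [C 0 < B 1], every [C j] is below [B 1] and row 0 is a multiple of row 1. *)
have [CB1|BC1] := ltnP (C 0%N) (B 1%N).
  have N0 : (1 < N.+1)%N.
    by rewrite ltnS lt0n; apply/eqP => N0; have := BC 0%N isT; rewrite N0; lia.
  pose i1 := Ordinal N0; pose c := \prod_(B 1%N <= t < B 0%N) (x - al t).
  rewrite (@det_row_op _ _ ord0 i1 c) // (expand_det_row _ ord0) big1 ?mul0r // => j _.
  rewrite !mxE /= (@gen_split (B 0%N) (B 1%N)) ?subrr ?mul0r //; last exact/ltnW/dB.
  by apply: leq_ltn_trans CB1; apply: Cle; rewrite leq0n ltn_ord.
have minorE (A : 'M[R]_N.+1) :
    (forall (i j : 'I_N), A (lift ord0 i) (lift ord0 j) = gen (B i.+1) (C j.+1)) ->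
    cofactor A ord0 ord0
      = \prod_(i < N) wt (B (lift ord0 i)) (C (lift ord0 i)) (B (lift ord0 i).+1).
  move=> AE; rewrite /cofactor addn0 expr0 mul1r -IH; congr (\det _).
  by apply/matrixP => i j; rewrite !mxE AE.
(* If [B 1 = C 0], subtracting [c] times row 1 leaves only the corner in row 0: x + y minus x - al Q
   gives the factor y + al Q. *)
case: eqP => [BC1e|/eqP BC1n].
  have N0 : (1 < N.+1)%N.
    by rewrite ltnS lt0n; apply/eqP => N0; have := BC 0%N isT; rewrite N0; lia.
  pose i1 := Ordinal N0; pose c := \prod_(B 1%N <= t < B 0%N) (x - al t).
  have B10 := dB 0%N isT.
  rewrite (@det_row_op _ _ ord0 i1 c) // (expand_det_row _ ord0) big_ord_recl big1 ?addr0.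
    rewrite minorE; last by move=> i j; rewrite !mxE.
    congr (_ * _); rewrite !mxE /= -BC1e gen_gt // /c (big_ltn B10) /gen ltnn eqxx.
    by ring.
  move=> j _; rewrite !mxE /= (@gen_split (B 0%N) (B 1%N)) ?subrr ?mul0r //; last exact/ltnW.
  rewrite BC1e; apply: leq_ltn_trans (dC 0%N N0); apply: Cle.
  by have := ltn_ord j; rewrite /= /bump /=; lia.
(* Now [B 1 < C 0], so the first column is zero below the corner. *)
rewrite (expand_det_col _ ord0) big_ord_recl big1 ?addr0 => [|i _].
  by rewrite minorE => [|i j]; rewrite !mxE.
rewrite mxE gen_lt ?mul0r //.
apply: (@leq_ltn_trans (B 1%N)); first by apply: Ble; rewrite /= ltnW // ltnS ltn_ord.
by rewrite ltn_neqAle BC1n.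
Qed.

End HookDeterminant.

(** * Thin skew diagrams *)

Section SkewHooks.
Variables (F : fieldType) (K N : nat) (a : int -> F) (u v : F).
Notation box := ('I_K * 'I_K)%type.
Variables la mu : nat -> nat.
Hypothesis leNK : (N <= K)%N.
Hypothesis la_ni : forall i, (la i.+1 <= la i)%N.
Hypothesis mu_ni : forall i, (mu i.+1 <= mu i)%N.
Hypothesis mu_sup : forall i, (N <= i)%N -> mu i = 0%N.
Hypothesis mu_le : forall i, (mu i <= K)%N.
Hypothesis la_mu : forall i, (la i <= mu i)%N.
Hypothesis thin : forall i, (mu i.+1 <= (la i).+1)%N.

(** By [thin], rows i and i+1 have at most the column [la i] in common: there is no 2x2 block. *)
Definition skew : {set box} := [set b : box | la b.1 <= b.2 < mu b.1]%N.

Definition pred_ord (j : 'I_K) : 'I_K := Ordinal (leq_ltn_trans (leq_pred j) (ltn_ord j)).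
Definition succ_ord (i : 'I_K) : 'I_K := insubd i i.+1.

(* A hook is traversed from north-east to south-west: one step goes to the left
   neighbour if there is one, else to the neighbour below, else stops. *)
Definition hook_next (b : box) : box :=
  if (la b.1 < b.2)%N then (b.1, pred_ord b.2)
  else if (b.2 < mu b.1.+1)%N then (succ_ord b.1, b.2)
  else b.

Lemma succ_ordE (b : box) : (b.2 < mu b.1.+1)%N -> succ_ord b.1 = b.1.+1 :> nat.
Proof.
move=> lt_b; rewrite /succ_ord val_insubd; case: ltnP => // Kb.
by move: lt_b; rewrite mu_sup // (leq_trans leNK).
Qed.

Variant next_spec (b : box) : box -> bool -> bool -> Prop :=
  | NextLeft (b' : box) of b'.1 = b.1 :> nat & b'.2.+1 = b.2 :> nat & (la b.1 < b.2)%N :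
      next_spec b b' true false
  | NextBelow (b' : box) of b'.1 = b.1.+1 :> nat & b'.2 = b.2 :> nat & (b.2 <= la b.1)%N
      & (b.2 < mu b.1.+1)%N : next_spec b b' false true
  | NextNone of (b.2 <= la b.1)%N & (mu b.1.+1 <= b.2)%N : next_spec b b false false.

(** The two tests are never both true, since that would contradict [thin]. *)
Lemma nextP b : next_spec b (hook_next b) (la b.1 < b.2)%N (b.2 < mu b.1.+1)%N.
Proof.
rewrite /hook_next; have := thin b.1.
case: (ltnP (la b.1)) => [lt_b|le_b]; case: (ltnP b.2) => [lt2|le2] th; try lia.
- by constructor=> //=; lia.
- by constructor=> //=; apply: succ_ordE.
- by constructor.
Qed.

Lemma skewP (b : box) : reflect (la b.1 <= b.2 < mu b.1)%N (b \in skew).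
Proof. by rewrite inE; apply: idP. Qed.

Lemma next_skew b : b \in skew -> hook_next b \in skew.
Proof.
move=> /skewP bs; apply/skewP; have := la_ni b.1; have := mu_ni b.1.
case: (nextP b) => [b' e1 e2 lt_b|b' e1 e2 le_b lt_b|//]; rewrite e1 ?e2 => _ le_la; first lia.
by rewrite lt_b andbT (leq_trans le_la) //; case/andP: bs.
Qed.

Lemma box_eq (b b' : box) : b.1 = b'.1 :> nat -> b.2 = b'.2 :> nat -> b = b'.
Proof. by case: b b' => [i j] [i' j'] /= /val_inj -> /val_inj ->. Qed.

Lemma next_left (b b' : box) : b \in skew -> b.1 = b'.1 :> nat -> b.2.+1 = b'.2 :> nat ->
  hook_next b' = b.
Proof.
move=> /skewP bs e1 e2; rewrite e1 in bs.
by case: (nextP b') => [c d1 d2 lt_b|c d1 d2 le_b lt_b|]; [apply: box_eq|..]; lia.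
Qed.

Lemma next_below (b b' : box) : b' \in skew -> b \in skew ->
  b.1.+1 = b'.1 :> nat -> b.2 = b'.2 :> nat -> hook_next b = b'.
Proof.
move=> /skewP bs' /skewP bs e1 e2; rewrite -e1 -e2 in bs'; have := thin b.1.
by case: (nextP b) => [c d1 d2 lt_b|c d1 d2 le_b lt_b|]; [|move=> _; apply: box_eq|..]; lia.
Qed.

(** Every side is crossed by one step of the traversal, so connectivity reduces to iterating
    [hook_next]. *)
Lemma adjb_next b b' : b \in skew -> b' \in skew -> adjb b b' ->
  hook_next b = b' \/ hook_next b' = b.
Proof.
move=> bs bs' /orP[]/andP[/eqP e /orP[]/eqP e'].
- by right; apply: next_left.
- by left; apply: next_left.
- by left; apply: next_below.
- by right; apply: next_below.
Qed.

Lemma adj_next b : b \in skew -> hook_next b = b \/ adj skew b (hook_next b).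
Proof.
move=> bs; have := next_skew bs; rewrite /adj bs /adjb.
case: (nextP b) => [c d1 d2 lt_b|c d1 d2 le_b lt_b|le_b mu_b cs]; last by left.
- by move=> -> /=; right; rewrite d1 d2 !eqxx orbT.
- by move=> -> /=; right; rewrite d1 d2 !eqxx orbT.
Qed.

Definition hook_end (b : box) : box := iter (K + K) hook_next b.

(** Each proper step moves left or down and lowers [size_left], so K + K steps are enough. *)
Lemma next_hook_end b : hook_next (hook_end b) = hook_end b.
Proof.
pose size_left (b : box) := (b.2 + (K - b.1))%N.
have : (size_left b <= K + K)%N.
  by rewrite leq_add ?leq_subr // ltnW.
rewrite /hook_end; elim: (K + K)%N b => [|n IH] b.
  rewrite /size_left leqn0 addn_eq0 => /andP[_]; rewrite subn_eq0 leqNgt ltn_ord //.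
move=> le_b; rewrite iterSr; have [e|ne] := eqVneq (hook_next b) b.
  by rewrite e (iter_fix _ e) e.
apply: IH; move: le_b ne; rewrite /size_left; have := ltn_ord b.1.
by case: (nextP b) => [c d1 d2 lt_b|c d1 d2 le_b lt_b|_ _]; rewrite ?eqxx //; lia.
Qed.

Lemma hook_end_next b : hook_end (hook_next b) = hook_end b.
Proof. by rewrite /hook_end -iterSr iterS next_hook_end. Qed.

Lemma hook_end_fix b : hook_next b = b -> hook_end b = b.
Proof. exact: iter_fix. Qed.

Lemma connect_hook_end b : b \in skew ->
  (hook_end b \in skew) && connect (adj skew) b (hook_end b).
Proof.
move=> bs; rewrite /hook_end; elim: (K + K)%N => [|n /andP[IH1 IH2]] /=.
  by rewrite bs connect0.
rewrite next_skew //=; case: (adj_next IH1) => [->//|e].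
exact: connect_trans IH2 (connect1 e).
Qed.

Lemma connect_eq_hook_end b b' : connect (adj skew) b b' -> hook_end b = hook_end b'.
Proof.
pose same := [pred z | hook_end z == hook_end b].
have cl : closed (adj skew) same.
  move=> z z' /and3P[zs zs' zz]; rewrite !inE.
  by case: (adjb_next zs zs' zz) => <-; rewrite hook_end_next.
by move=> /(closed_connect cl); rewrite !inE eqxx => /esym/eqP.
Qed.

Lemma adj_connect_sym : connect_sym (adj skew).
Proof.
apply: sym_connect_sym => b b'; rewrite /adj /adjb andbCA [b.1 == _ :> nat]eq_sym.
by rewrite [b.2 == _ :> nat]eq_sym; do 2!(congr (_ && _)); congr (_ || _); rewrite orbC.
Qed.

Definition hook_of (b : box) : {set box} := [set b' in skew | connect (adj skew) b b'].

Lemma mem_hook_of b b' : (b' \in hook_of b) = (b' \in skew) && connect (adj skew) b b'.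
Proof. by rewrite in_set. Qed.

Lemma hook_of_eq b b' : b' \in hook_of b -> hook_of b' = hook_of b.
Proof.
rewrite mem_hook_of => /andP[_ cb]; apply/setP => z; rewrite !mem_hook_of; congr (_ && _).
by rewrite (same_connect adj_connect_sym cb).
Qed.

Lemma next_hook_of b b' : b' \in hook_of b -> hook_next b' \in hook_of b.
Proof.
rewrite !mem_hook_of => /andP[/[dup] bs /next_skew -> cb].
by case: (adj_next bs) => [->//|/connect1]; apply: connect_trans.
Qed.

(** Each interior side is charged to the box from which the traversal crosses it, the right or the
    upper one; the end of the hook, which crosses none, receives u + v. *)
Definition box_factor i j : F :=
  if (la i < j)%N then u - a (Posz j - Posz i)
  else if (j < mu i.+1)%N then v + a (Posz j - Posz i) else u + v.

Lemma fhook_hook_of b0 : b0 \in skew ->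
  fhook a (hook_of b0) u v = \prod_(b in hook_of b0) box_factor b.1 b.2.
Proof.
move=> b0s; set D := hook_of b0.
have Ds b : b \in D -> b \in skew by rewrite mem_hook_of => /andP[].
rewrite (bigID (fun b : box => la b.1 < b.2)%N) /=.
rewrite [X in _ * X](bigID (fun b : box => b.2 < mu b.1.+1)%N) /=.
rewrite /fhook [X in X * _]mulrC -mulrA [X in _ * X]mulrC; congr (_ * (_ * _)).
(* Vertical sides correspond to boxes with a left neighbour. *)
- rewrite (reindex_onto (fun b => (hook_next b, b)) (fun p => p.2)) /=; last first.
    move=> [p q] /= /and4P[pD _ /eqP e1 /eqP e2]; congr (_, _).
    by apply: next_left => //; apply: Ds.
  apply: eq_big => [b|b]; rewrite ?eqxx ?andbT.
    have [bD|] := boolP (b \in D); last by rewrite andbF.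
    rewrite (next_hook_of bD) /=.
    by case: (nextP b) => [c d1 d2 lt_b|c d1 d2 le_b lt_b|_ _]; lia.
  move=> /and4P[_ _ /eqP e1 /eqP e2]; rewrite /box_factor; move: e1 e2.
  by case: (nextP b) => [c d1 d2 lt_b|c d1 d2 le_b lt_b|_ _] e1 e2; [congr (u - a _)|..]; lia.
(* Horizontal sides correspond to boxes with a neighbour below. *)
- rewrite (reindex_onto (fun b => (b, hook_next b)) (fun p => p.1)) /=; last first.
    move=> [p q] /= /and4P[pD qD /eqP e1 /eqP e2]; congr (_, _).
    by apply: next_below => //; apply: Ds.
  apply: eq_big => [b|b]; rewrite ?eqxx ?andbT.
    have [bD|] := boolP (b \in D); last by [].
    rewrite (next_hook_of bD) /=.
    by case: (nextP b) => [c d1 d2 lt_b|c d1 d2 le_b lt_b|_ _]; lia.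
  move=> /and4P[_ _ /eqP e1 /eqP e2]; rewrite /box_factor; move: e1 e2.
  by case: (nextP b) => [c d1 d2 lt_b|c d1 d2 le_b lt_b|_ _] //; lia.
(* A component contains exactly one box without successor, as [hook_end] is constant on it. *)
- rewrite (eq_bigl (pred1 (hook_end b0))) /= ?big_pred1_eq => [|b].
    rewrite /box_factor; case: nextP (next_hook_end b0) => //= b' e1 e2 _ => [|_] e;
      by rewrite e in e1 e2; lia.
  apply/idP/eqP => [|->].
    rewrite -andbA => /and3P[bD]; rewrite mem_hook_of in bD.
    case/andP: bD => _ /connect_eq_hook_end ->.
    move: (@hook_end_fix b).
    by case: (nextP b) => // _ _ e _ _; rewrite e.
  have /andP[es ec] := connect_hook_end b0s.
  rewrite mem_hook_of es ec /=.
  by case: nextP (next_hook_end b0) => //= b' e1 e2 _ => [|_] e; rewrite e in e1 e2; lia.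
Qed.

Lemma fdiag_skew_boxes : fdiag a skew u v = \prod_(b in skew) box_factor b.1 b.2.
Proof.
rewrite (partition_big_imset hook_of) /=; apply: eq_bigr => D /imsetP[b0 b0s ->].
rewrite -/(hook_of b0) fhook_hook_of //; apply: eq_bigl => b.
apply/idP/andP => [bD|[bs /eqP <-]]; last by rewrite mem_hook_of bs connect0.
by rewrite (hook_of_eq bD); move: bD; rewrite mem_hook_of => /andP[-> _].
Qed.

Lemma prod_ord_widen n (P : pred nat) (G : nat -> F) : (n <= K)%N ->
  (forall i, P i -> (i < n)%N) -> \prod_(i < K | P i) G i = \prod_(i < n | P i) G i.
Proof.
move=> nK Pn; rewrite [RHS](big_ord_widen_cond K) //; apply: eq_bigl => i.
by case Pi: (P i); rewrite //= Pn.
Qed.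

(** In each nonempty row, all boxes but the leftmost contribute u - a; the leftmost gives v + a or u
    + v according to whether the next row reaches under it, which in beta-numbers reads P2 = Q. *)
Lemma fdiag_skew : fdiag a skew u v =
  \prod_(i < N) wt u v (fun t => a (Posz t - Posz N))
      (mu i + (N - i)) (la i + (N - i)) (mu i.+1 + (N - i.+1)).
Proof.
rewrite fdiag_skew_boxes.
rewrite (eq_bigl (fun b : box => (la b.1 <= b.2 < mu b.1)%N)); last by move=> b; rewrite inE.
rewrite -(pair_big_dep xpredT (fun i j : 'I_K => la i <= j < mu i)%N
   (fun i j : 'I_K => box_factor i j)) /=.
have rowE i : \prod_(j < K | (la i <= j < mu i)%N) box_factor i j
    = \prod_(la i <= j < mu i) box_factor i j.
  rewrite (@prod_ord_widen (mu i) (fun j => la i <= j < mu i)%N (box_factor i)) //.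
    by rewrite big_geq_mkord; apply: eq_bigl => j; rewrite ltn_ord andbT.
  by move=> j /andP[].
rewrite (eq_bigr _ (fun (i : 'I_K) _ => rowE i)).
rewrite -[LHS](big_mkord xpredT (fun i => \prod_(la i <= j < mu i) box_factor i j)).
rewrite (big_cat_nat (n := N)) //= [X in _ * X]big1_seq ?mulr1; last first.
  by move=> i; rewrite mem_index_iota => /andP[_ /andP[Ni _]]; rewrite big_geq // mu_sup.
rewrite big_mkord; apply: eq_bigr => i _.
have iN := ltn_ord i; have := la_mu i; have := thin i; have := mu_ni i => h1 h2 h3.
rewrite /wt.
have -> : (mu i + (N - i) < la i + (N - i))%N = false by lia.
have -> : (la i + (N - i) < mu i.+1 + (N - i.+1))%N = false by lia.
have -> : (mu i.+1 + (N - i.+1) == la i + (N - i))%N = (la i < mu i.+1)%N by lia.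
have tailE : \prod_((la i + (N - i)).+1 <= t < mu i + (N - i)) (u - a (Posz t - Posz N))
    = \prod_((la i).+1 <= j < mu i) box_factor i j.
  rewrite -addSn big_addn addnK; apply: eq_big_nat => j /andP[j1 _].
  by rewrite /box_factor j1; congr (u - a _); lia.
have [e|lt_i] := leqP (mu i) (la i).
  rewrite big_geq //; have -> : (la i < mu i.+1)%N = false by lia.
  have e' : la i = mu i by lia.
  by rewrite /gen e' ltnn eqxx.
rewrite big_ltn // tailE {1}/box_factor ltnn; case: ifP => _.
  by congr ((v + a _) * _); lia.
by rewrite gen_gt ?tailE //; lia.
Qed.

End SkewHooks.

(** * Diagonal-strict tableaux *)

Section Tableaux.
Variables (F : fieldType) (K N : nat) (a : int -> F) (x y : nat -> F).
Notation box := ('I_K * 'I_K)%type.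
Notation betas := {ffun 'I_N -> 'I_(N + K)}.
Implicit Types (mu la : nat -> nat) (f : betas).

Definition boxed_part mu :=
  [/\ forall i, (mu i.+1 <= mu i)%N, forall i, (N <= i)%N -> mu i = 0%N
    & forall i, (mu i <= K)%N].

Lemma nonincr_le mu i j : (forall i, (mu i.+1 <= mu i)%N) -> (i <= j)%N -> (mu j <= mu i)%N.
Proof.
move=> ni; elim: j => [|j IH]; first by rewrite leqn0 => /eqP ->.
by rewrite leq_eqVlt => /predU1P[-> //|ij]; apply: leq_trans (ni j) (IH ij).
Qed.

Definition dst mu M (T : {ffun box -> 'I_M.+1}) : bool :=
  [forall b : box, (val (T b) != 0%N) == (b.2 < mu b.1)%N] &&
  [forall b : box, forall b' : box, ((b.2 < mu b.1)%N && (b'.2 < mu b'.1)%N) ==>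
     [&& ((b.1 == b'.1) && (b.2 <= b'.2)%N) ==> (T b <= T b')%N,
         ((b.2 == b'.2) && (b.1 <= b'.1)%N) ==> (T b <= T b')%N &
         (((b.2 : int) - (b.1 : int) == (b'.2 : int) - (b'.1 : int))
            && (b.1 < b'.1)%N) ==> (T b < T b')%N]].

Lemma dstab_dst (s : seq nat) M (T : {ffun box -> 'I_M.+1}) :
  dstab s T = dst (nth 0%N s) T.
Proof.
have shE (b : box) : inshape s b = (b.2 < nth 0%N s b.1)%N.
  by rewrite /inshape; case: ltnP => // sb; rewrite nth_default.
rewrite /dstab /dst; congr (_ && _); first by apply: eq_forallb => b; rewrite shE.
by apply: eq_forallb => b; apply: eq_forallb => b'; rewrite !shE.
Qed.

Lemma dstP mu M (T : {ffun box -> 'I_M.+1}) : reflect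
  ((forall b : box, (T b != 0%N :> nat) = (b.2 < mu b.1)%N) /\
   (forall b b' : box, (b.2 < mu b.1)%N -> (b'.2 < mu b'.1)%N ->
     [/\ b.1 = b'.1 :> nat -> (b.2 <= b'.2)%N -> (T b <= T b')%N,
         b.2 = b'.2 :> nat -> (b.1 <= b'.1)%N -> (T b <= T b')%N &
         (b.2 + b'.1 = b'.2 + b.1)%N -> (b.1 < b'.1)%N -> (T b < T b')%N]))
  (dst mu T).
Proof.
apply: (iffP andP) => [[/forallP H1 /forallP H2]|[H1 H2]]; split.
- by move=> b; have /eqP := H1 b.
- move=> b b' sb sb'; have /forallP/(_ b') := H2 b; rewrite sb sb' /=.
  case/and3P=> /implyP A /implyP B /implyP C; split=> e l.
  + by apply: A; rewrite l andbT; apply/eqP/val_inj.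
  + by apply: B; rewrite l andbT; apply/eqP/val_inj.
  + by apply: C; rewrite l andbT; apply/eqP; lia.
- by apply/forallP => b; apply/eqP/H1.
- apply/forallP => b; apply/forallP => b'; apply/implyP => /andP[sb sb'].
  have [A B C] := H2 _ _ sb sb'.
  apply/and3P; split; apply/implyP => /andP[/eqP e l]; [apply: A|apply: B|apply: C] => //.
  + by rewrite e.
  + by rewrite e.
  + by lia.
Qed.

(** [f k] stores the beta-number minus 1, so that the values 1, ..., N + K fit into ['I_(N + K)]. *)
Definition part_of f (i : nat) : nat :=
  if insub i is Some k then ((f k).+1 - (N - i))%N else 0%N.

Lemma part_ofE f (k : 'I_N) : part_of f k = ((f k).+1 - (N - k))%N.
Proof. by rewrite /part_of valK. Qed.

Lemma part_of_out f i : (N <= i)%N -> part_of f i = 0%N.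
Proof. by move=> Ni; rewrite /part_of insubN // -leqNgt. Qed.

(** The truncated subtraction in [part_of] is exact: N - k - 1 further values lie below [f k]. *)
Lemma decr_ge f (k : 'I_N) : decr f -> (N - k <= (f k).+1)%N.
Proof.
move=> /decrP df; have [n] := ubnP (N - k); elim: n k => // n IH k kn.
have [Nk|kN] := leqP N k.+1; first by lia.
have := IH (Ordinal kN); have := df k (Ordinal kN) (ltnSn k) => /=; lia.
Qed.

Lemma part_of_beta f (k : 'I_N) : decr f -> (part_of f k + (N - k))%N = (f k).+1.
Proof. by move=> df; rewrite part_ofE subnK // decr_ge. Qed.

Lemma part_of_partn f : decr f -> boxed_part (part_of f).
Proof.
move=> df; have ni i : (part_of f i.+1 <= part_of f i)%N.
  have [Ni|iN] := leqP N i.+1; first by rewrite part_of_out.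
  have /decrP dfP := df; have := dfP (Ordinal (ltnW iN)) (Ordinal iN) (ltnSn i).
  have := part_of_beta (Ordinal (ltnW iN)) df; have := part_of_beta (Ordinal iN) df => /=.
  lia.
split=> // [i /part_of_out //|i]; apply: (leq_trans (nonincr_le ni (leq0n i))).
have [N0|N0] := posnP N; first by rewrite part_of_out // N0.
have := part_of_beta (Ordinal N0) df; have := ltn_ord (f (Ordinal N0)) => /=; lia.
Qed.

Hypothesis leNK : (N <= K)%N.

Definition row_count M (T : {ffun box -> 'I_M.+2}) (k : 'I_N) : nat :=
  #|[set j : 'I_K | (0 < T (widen_ord leNK k, j) < M.+1)%N]|.

Lemma shape_of_proof M (T : {ffun box -> 'I_M.+2}) (k : 'I_N) :
  (row_count T k + (N - k.+1) < N + K)%N.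
Proof.
have : (row_count T k <= K)%N by apply: leq_trans (max_card _) _; rewrite card_ord.
have := ltn_ord k; lia.
Qed.

(* The beta-numbers of the shape formed by the entries at most [M]. *)
Definition shape_of M (T : {ffun box -> 'I_M.+2}) : betas :=
  [ffun k => Ordinal (shape_of_proof T k)].

Lemma part_of_shape_of M (T : {ffun box -> 'I_M.+2}) (k : 'I_N) :
  part_of (shape_of T) k = row_count T k.
Proof. by rewrite part_ofE ffunE /=; have := ltn_ord k; lia. Qed.

Lemma shape_of_decr M (T : {ffun box -> 'I_M.+2}) mu :
  boxed_part mu -> dst mu T -> decr (shape_of T).
Proof.
move=> [ni _ _] /dstP[T1 T2]; apply/decrP => i j ij; rewrite !ffunE /=.
suff : (row_count T j <= row_count T i)%N by have := ltn_ord j; lia.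
apply/subset_leq_card/subsetP => k; rewrite !inE => /andP[Tj0 TjM].
pose b : box := (widen_ord leNK i, k); pose b' : box := (widen_ord leNK j, k).
have sb' : (b'.2 < mu b'.1)%N by rewrite -T1 -lt0n.
have sb : (b.2 < mu b.1)%N.
  by apply: leq_trans sb' _; apply: nonincr_le ni _; apply: ltnW.
have [_ H _] := T2 _ _ sb sb'.
rewrite lt0n (T1 b) sb /=; apply: leq_ltn_trans TjM; apply: H => //; exact: ltnW.
Qed.

Lemma card_down_closed (S : {set 'I_K}) (j : 'I_K) :
  (forall i i' : 'I_K, (i <= i')%N -> i' \in S -> i \in S) ->
  (j < #|S|)%N = (j \in S).
Proof.
move=> dc; have cI : #|[set i : 'I_K | (i < j)%N]| = j.
  rewrite cardsE -sum1_card (big_ord_narrow (ltnW (ltn_ord j))) /=.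
  by rewrite sum1_card card_ord.
have [jS|jS] := boolP (j \in S).
  rewrite -cI; apply/proper_card/properP; split; last by exists j; rewrite ?inE ?ltnn.
  by apply/subsetP => i; rewrite inE => /ltnW ij; apply: dc jS.
apply/negbTE; rewrite -leqNgt -cI; apply/subset_leq_card/subsetP => i iS.
by rewrite inE ltnNge; apply/negP => ji; move/negP: jS; apply; apply: dc iS.
Qed.

(** Rows increase weakly, so the entries from 1 to M fill an initial segment of each row and
    counting them locates them. *)
Lemma mem_part_of_shape M (T : {ffun box -> 'I_M.+2}) mu (b : box) :
  boxed_part mu -> dst mu T -> (b.2 < part_of (shape_of T) b.1)%N = (0 < T b < M.+1)%N.
Proof.
move=> [ni sup _] /dstP[T1 T2]; have [Nb|bN] := leqP N b.1.
  by rewrite part_of_out // lt0n T1 sup.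
have -> : part_of (shape_of T) b.1 = row_count T (Ordinal bN).
  by rewrite -part_of_shape_of.
have e j : (widen_ord leNK (Ordinal bN), j) = (b.1, j) :> box.
  by congr (_, _); apply: val_inj.
rewrite /row_count card_down_closed ?inE ?e -?surjective_pairing // => i i' ii'.
rewrite !inE !e => /andP[Ti0 TiM].
have sb' : ((b.1, i').2 < mu (b.1, i').1)%N by rewrite -T1 -lt0n.
have sb : ((b.1, i).2 < mu (b.1, i).1)%N by apply: leq_ltn_trans sb'.
have [H _ _] := T2 _ _ sb sb'.
by rewrite lt0n T1 sb /=; apply: leq_ltn_trans TiM; apply: H.
Qed.

(** * Removing and restoring the largest letter *)

Definition trunc M (T : {ffun box -> 'I_M.+2}) : {ffun box -> 'I_M.+1} :=
  [ffun b => inord (if (T b <= M)%N then nat_of_ord (T b) else 0%N)].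

Definition extend mu M (T : {ffun box -> 'I_M.+1}) : {ffun box -> 'I_M.+2} :=
  [ffun b => inord (if T b != 0%N :> nat then nat_of_ord (T b)
                    else if (b.2 < mu b.1)%N then M.+1 else 0%N)].

Lemma truncE M (T : {ffun box -> 'I_M.+2}) b :
  trunc T b = (if (T b <= M)%N then nat_of_ord (T b) else 0%N) :> nat.
Proof. by rewrite ffunE inordK //; case: ifP. Qed.

Lemma extendE mu M (T : {ffun box -> 'I_M.+1}) b :
  extend mu T b = (if T b != 0%N :> nat then nat_of_ord (T b)
                    else if (b.2 < mu b.1)%N then M.+1 else 0%N) :> nat.
Proof.
rewrite ffunE inordK //; case: ifP => _; last by case: ifP.
by apply: leq_trans (ltn_ord _) _.
Qed.

Lemma truncK mu M (T : {ffun box -> 'I_M.+2}) : dst mu T -> extend mu (trunc T) = T.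
Proof.
move=> /dstP[T1 _]; apply/ffunP => b; apply: val_inj; rewrite /= extendE truncE.
have := T1 b; have := ltn_ord (T b); rewrite ltnS leq_eqVlt.
case/predU1P => [e|lt_b]; first by rewrite e ltnn eqxx /= => <-.
rewrite ltnS in lt_b; rewrite lt_b => <-.
by have [e|ne] := eqVneq (T b : nat) 0%N; rewrite /= ?e ?ne ?eqxx.
Qed.

Section Branching.
Variables (mu : nat -> nat) (M : nat) (f : betas).
Hypothesis mu_partn : boxed_part mu.
Hypothesis f_decr : decr f.
Notation la := (part_of f).

Definition thin_pair := [forall i : 'I_N, (la i <= mu i)%N && (mu i.+1 <= (la i).+1)%N].

Lemma thin_pairP : thin_pair ->
  (forall i, (la i <= mu i)%N) /\ (forall i, (mu i.+1 <= (la i).+1)%N).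
Proof.
case: mu_partn => ni sup _ /forallP th; split=> i; have [Ni|iN] := leqP N i.
- by rewrite part_of_out.
- by have /andP[] := th (Ordinal iN).
- by rewrite sup // leqW.
- by have /andP[] := th (Ordinal iN).
Qed.

Lemma shape_of_thin (T : {ffun box -> 'I_M.+2}) :
  dst mu T -> shape_of T = f -> thin_pair.
Proof.
move=> dT sT; have memT b := mem_part_of_shape b mu_partn dT.
rewrite sT in memT; case/dstP: dT => T1 T2; have [ni sup le_muK] := mu_partn.
have [la_ni _ le_laK] := part_of_partn f_decr.
apply/forallP => i; apply/andP; split; rewrite leqNgt; apply/negP => lt_i.
  have lt_muK : (mu i < K)%N by apply: leq_trans lt_i (le_laK _).
  have := memT (widen_ord leNK i, Ordinal lt_muK); rewrite /= lt_i => /esym/andP[].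
  by rewrite lt0n T1 /= ltnn.
have lt_iN : (i.+1 < N)%N.
  by rewrite ltnNge; apply/negP => Ni; rewrite sup in lt_i.
have lt_laK : ((la i).+1 < K)%N by apply: leq_trans lt_i (le_muK _).
(* Opposite corners of a 2x2 block outside [la]: the first entry already exceeds M, so strictness on
   the diagonal would push the second above M.+1. *)
pose b : box := (widen_ord leNK i, Ordinal (ltnW lt_laK)).
pose b' : box := (Ordinal (leq_trans lt_iN leNK), Ordinal lt_laK).
have sb : (b.2 < mu b.1)%N by rewrite /=; have := ni i; lia.
have sb' : (b'.2 < mu b'.1)%N by [].
have [_ _ H] := T2 _ _ sb sb'.
have {}H : (T b < T b')%N by apply: H => /=; lia.
have := memT b; rewrite /= ltnn lt0n T1 sb /=.
by have := ltn_ord (T b'); lia.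
Qed.

Lemma trunc_extend (T : {ffun box -> 'I_M.+1}) : trunc (extend mu T) = T.
Proof.
apply/ffunP => b; apply: val_inj; rewrite /= truncE extendE.
case: eqVneq => [e|_] /=; last by rewrite -ltnS ltn_ord.
by rewrite e; case: (b.2 < mu b.1)%N; rewrite ?ltnn.
Qed.

Lemma shape_extend (T : {ffun box -> 'I_M.+1}) : dst la T -> shape_of (extend mu T) = f.
Proof.
move=> /dstP[T1 _]; apply/ffunP => k; apply: val_inj; rewrite ffunE /=.
have [_ _ le_laK] := part_of_partn f_decr.
have -> : row_count (extend mu T) k = la k.
  rewrite /row_count -[RHS]card_ord (eq_card (B := [pred j : 'I_K | (j < la k)%N])).
    by rewrite -sum1_card (big_ord_narrow (le_laK k)) sum1_card.
  move=> j; rewrite !inE extendE T1 /=; case: (ltnP j (la k)) => [lj|lj].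
    by rewrite lt0n T1 /= lj ltn_ord.
  by case: (j < mu k)%N; rewrite ?ltnn.
have := part_of_beta k f_decr; have := ltn_ord k; lia.
Qed.

Hypothesis thinf : thin_pair.

(** New boxes carry the maximum M.+1, and thinness keeps two of them off a common diagonal; a box
    weakly above and to the left of a box of [la] is again in [la]. *)
Lemma dst_extend (T : {ffun box -> 'I_M.+1}) : dst la T -> dst mu (extend mu T).
Proof.
move=> /dstP[T1 T2]; have [la_mu th] := thin_pairP thinf.
have [ni _ _] := mu_partn; have [la_ni _ _] := part_of_partn f_decr.
have out (b : box) : (b.2 < mu b.1)%N -> ~~ (b.2 < la b.1)%N -> extend mu T b = M.+1 :> nat.
  by move=> sb lb; rewrite extendE T1 (negPf lb) sb.
have inn (b : box) : (b.2 < la b.1)%N -> extend mu T b = T b :> nat.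
  by move=> lb; rewrite extendE T1 lb.
have leM (b : box) : (extend mu T b <= M.+1)%N by rewrite -ltnS ltn_ord.
apply/dstP; split=> [b|b b' sb sb'].
  rewrite extendE T1; case: ltnP => [lb|lb]; last by case: ltnP.
  by rewrite T1 lb (leq_trans lb).
have [lb'|lb'] := boolP (b'.2 < la b'.1)%N; last first.
  rewrite (out b') //; split=> [||e l]; [by []|by []|].
  have [lb|lb] := boolP (b.2 < la b.1)%N; first by rewrite inn.
  have := th b.1; have := nonincr_le ni l; lia.
have lb : (b.1 <= b'.1)%N -> (b.2 <= b'.2)%N -> (b.2 < la b.1)%N.
  by move=> l1 l2; have := nonincr_le la_ni l1; lia.
split=> e l; (have lb0 : (b.2 < la b.1)%N by apply: lb; lia); have [A B C] := T2 _ _ lb0 lb';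
  rewrite !inn //.
- exact: A.
- exact: B.
- exact: C.
Qed.

Lemma dst_trunc (T : {ffun box -> 'I_M.+2}) :
  dst mu T -> shape_of T = f -> dst la (trunc T).
Proof.
move=> dT sT; have memT b := mem_part_of_shape b mu_partn dT.
rewrite sT in memT; case/dstP: dT => T1 T2; have [la_mu _] := thin_pairP thinf.
apply/dstP; split=> [b|b b' lb lb'].
  by rewrite memT truncE ltnS; case: (leqP (T b) M); rewrite ?andbF // andbT lt0n.
have trE (c : box) : (c.2 < la c.1)%N -> trunc T c = T c :> nat.
  by rewrite memT truncE ltnS => /andP[_ ->].
rewrite !trE //; apply: T2; [exact: leq_trans lb (la_mu _)|exact: leq_trans lb' (la_mu _)].
Qed.

End Branching.

Definition tabsum mu M : F := \sum_(T : {ffun box -> 'I_M.+1} | dst mu T)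
  \prod_(1 <= k < M.+1) fdiag a [set b | val (T b) == k] (x k) (y k).

Notation al := (fun t : nat => a (Posz t - Posz N)).

Definition branch_wt mu la (u v : F) : F :=
  \prod_(i < N) wt u v al (mu i + (N - i)) (la i + (N - i)) (mu i.+1 + (N - i.+1)).

(** If the pair is not thin, both sides vanish. Otherwise [extend] and [trunc] are inverse
    bijections, and the boxes with entry M.+1 form mu/la. *)
Lemma branch_fixed_shape mu M f : boxed_part mu -> decr f ->
  \sum_(T : {ffun box -> 'I_M.+2} | dst mu T && (shape_of T == f))
    \prod_(1 <= k < M.+2) fdiag a [set b | val (T b) == k] (x k) (y k)
  = branch_wt mu (part_of f) (x M.+1) (y M.+1) * tabsum (part_of f) M.
Proof.
move=> pm df; have [th|nth] := boolP (thin_pair mu f); last first.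
  rewrite big_pred0 => [|T]; last first.
    apply/negbTE/negP => /andP[dT /eqP sT]; move/negP: nth; apply.
    exact: shape_of_thin dT sT.
  case/forallPn: nth => i; rewrite negb_and -!ltnNge => bad.
  rewrite /branch_wt (bigD1 i) //= /wt.
  have -> : (mu i + (N - i) < part_of f i + (N - i))%N
         || (part_of f i + (N - i) < mu i.+1 + (N - i.+1))%N.
    by have := ltn_ord i; lia.
  by rewrite !mul0r.
have [la_mu thm] := thin_pairP pm th; have [ni sup leK] := pm.
have [la_ni _ _] := part_of_partn df.
rewrite (reindex_onto (@extend mu M) (@trunc M)) => [|T /andP[dT _]]; last exact: truncK.
rewrite /tabsum mulr_sumr; apply: eq_big => [T|T /andP[/andP[dT /eqP sT] /eqP tT]].
  apply/idP/idP => [/andP[/andP[dT /eqP sT] /eqP <-]|dT]; first exact: dst_trunc.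
  by rewrite (dst_extend pm df th dT) (shape_extend _ df dT) trunc_extend !eqxx.
have dT' : dst (part_of f) T by rewrite -tT; apply: dst_trunc.
have /dstP[T1 _] := dT'.
rewrite big_nat_recr //= mulrC; congr (_ * _); last first.
  apply: eq_big_nat => k /andP[k1 kM]; congr (fdiag _ _ _ _); apply/setP => b.
  rewrite !inE extendE; case: (eqVneq (T b : nat) 0%N) => [->|//] /=.
  by case: (b.2 < mu b.1)%N; apply/eqP/eqP; lia.
rewrite /branch_wt -(fdiag_skew _ _ _ leNK) //; congr (fdiag _ _ _ _); apply/setP => b.
rewrite !inE extendE T1; case: (ltnP b.2 (part_of f b.1)) => lb /=.
  by rewrite ltn_eqF // ltn_ord.
by case: ifP => _; rewrite ?eqxx.
Qed.

Lemma tabsumS mu M : boxed_part mu ->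
  tabsum mu M.+1 = \sum_(f | decr f)
    branch_wt mu (part_of f) (x M.+1) (y M.+1) * tabsum (part_of f) M.
Proof.
move=> pm; rewrite {1}/tabsum (partition_big (@shape_of M) (@decr _ _)) /=.
  by apply: eq_bigr => f df; rewrite branch_fixed_shape.
by move=> T; apply: shape_of_decr.
Qed.

Lemma tabsum0 mu : boxed_part mu -> tabsum mu 0 = (mu 0%N == 0%N)%:R.
Proof.
move=> [ni sup leK]; rewrite /tabsum.
pose T0 : {ffun box -> 'I_1} := [ffun=> ord0].
have eT T : T = T0 by apply/ffunP => b; rewrite [RHS]ffunE ord1.
have dE : dst mu T0 = (mu 0%N == 0%N).
  apply/dstP/eqP => [[T1 _]|mu0].
    apply/eqP; rewrite -leqn0 leqNgt; apply/negP => mu0.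
    have K0 : (0 < K)%N by apply: leq_trans (leK 0%N).
    by have := T1 (Ordinal K0, Ordinal K0); rewrite ffunE /= mu0.
  have mu_0 i : mu i = 0%N by apply/eqP; rewrite -leqn0 -mu0; apply: nonincr_le.
  by split=> [b|b b']; rewrite mu_0 // ffunE.
rewrite big_mkcond (big_pred1 T0) => [|T]; last by rewrite [T]eT /= eqxx.
by rewrite dE big_geq //; case: ifP.
Qed.

End Tableaux.

(** * Branching of the determinant *)

Section DeterminantBranching.
Variables (F : fieldType) (K N : nat) (a : int -> F) (x y : nat -> F).
Hypothesis leNK : (N <= K)%N.
Hypothesis F0 : [pchar F] =i pred0.
Notation al := (fun t : nat => a (Posz t - Posz N)).

Definition det_entry (h : nat -> F) (Q j : nat) : F :=
  hka (tau (- (j%:Z)) a) h (Q%:Z - N%:Z + j%:Z).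

Lemma det_entry_lt h Q j : (Q < N - j)%N -> det_entry h Q j = 0.
Proof.
rewrite /det_entry => lt_Q.
by have -> : Q%:Z - N%:Z + j%:Z = Negz (N - j - Q).-1 by lia.
Qed.

Lemma det_entry_ge h Q j : (N - j <= Q)%N -> (j < N)%N ->
  det_entry h Q j = hka (tau (- (j%:Z)) a) h (Posz (Q - (N - j))).
Proof. by rewrite /det_entry => le_Q jN; congr (hka _ _ _); lia. Qed.

(** The shift [tau] cancels the column offset of the beta-numbers, so the coefficients do not depend
    on [j] and the matrix factors. Terms with Q < N - j vanish through [det_entry], those with Q > P
    through [gen]. *)
Lemma det_entry_coproduct (h h' : nat -> F) (u v : F) P j :
  h 0%N = 1 -> h' 0%N = 1 -> (forall k, h' k.+1 = u * h' k + h k.+1 + v * h k) ->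
  (P <= N + K)%N -> (j < N)%N ->
  det_entry h' P j = \sum_(q < N + K) gen u v al P q.+1 * det_entry h q.+1 j.
Proof.
move=> h0 h0' hh' leP jN.
have [lt_P|le_P] := ltnP P (N - j).
  rewrite det_entry_lt // big1 // => q _; have [lt_q|le_q] := ltnP P q.+1.
    by rewrite gen_lt ?mul0r.
  by rewrite det_entry_lt ?mulr0 // (leq_ltn_trans le_q).
rewrite -(big_mkord xpredT (fun q => gen u v al P q.+1 * det_entry h q.+1 j)).
rewrite -(big_add1 _ _ 0 (N + K).+1 xpredT (fun Q => gen u v al P Q * det_entry h Q j)).
set G := fun Q => _.
have d0 : (0 < N - j)%N by lia.
rewrite (big_cat_nat d0) /=; last by lia.
rewrite [X in X + _]big1_seq ?add0r; last first.
  move=> Q; rewrite mem_index_iota => /andP[_ /andP[_ lt_Q]].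
  by rewrite /G det_entry_lt ?mulr0.
rewrite (big_cat_nat (n := P.+1)) /=; [|by lia..].
rewrite [X in _ + X]big1_seq ?addr0; last first.
  move=> Q; rewrite mem_index_iota => /andP[_ /andP[lt_Q _]].
  by rewrite /G gen_lt ?mul0r.
rewrite big_nat_recr //= det_entry_ge // (hka_coproduct h0 h0' hh'); congr (_ + _); last first.
  by rewrite /G /gen ltnn eqxx mul1r det_entry_ge.
rewrite -[X in \sum_(X <= _ < _) _]add0n big_addn big_mkord; apply: eq_bigr => i _.
have lt_i := ltn_ord i.
rewrite /G det_entry_ge ?leq_addl // addnK gen_gt; last by lia.
congr (_ * _ * _); rewrite -addSn big_addn; apply: eq_big_nat => t _.
by rewrite /tau; congr (_ - a _); lia.
Qed.

Definition bdet mu M : F :=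
  \det (\matrix_(i < N, j < N) det_entry (hsp M x y) (mu i + (N - i)) j).

Lemma bdetS mu M : boxed_part K N mu ->
  bdet mu M.+1 = \sum_(f : {ffun 'I_N -> 'I_(N + K)} | decr f)
    branch_wt N a mu (part_of f) (x M.+1) (y M.+1) * bdet (part_of f) M.
Proof.
move=> [ni sup leK].
pose A : 'M[F]_(N, N + K) :=
  \matrix_(i, q) gen (x M.+1) (y M.+1) al (mu i + (N - i)) q.+1.
pose B : 'M[F]_(N + K, N) := \matrix_(q, j) det_entry (hsp M x y) q.+1 j.
have -> : bdet mu M.+1 = \det (A *m B).
  congr (\det _); apply/matrixP => i j; rewrite !mxE.
  rewrite (@det_entry_coproduct (hsp M x y) _ (x M.+1) (y M.+1)) //.
  - by apply: eq_bigr => q _; rewrite !mxE.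
  - by move=> k; apply: hspS.
  - by have := leK i; lia.
rewrite Cauchy_Binet; apply: eq_bigr => f df.
have [la_ni _ _] := part_of_partn df.
have fE := fun k => part_of_beta k df; congr (_ * _).
  rewrite /branch_wt -(@det_gen _ _ _ al N (fun i => mu i + (N - i))%N
      (fun i => part_of f i + (N - i))%N).
  - by congr (\det _); apply/matrixP => i j; rewrite !mxE fE.
  - by move=> i iN; have := ni i; lia.
  - by move=> i iN; have := la_ni i; lia.
  (* The sentinel is 0, while every beta-number of [part_of f] is positive. *)
  - by move=> i iN; rewrite sup //; lia.
by congr (\det _); apply/matrixP => i j; rewrite !mxE fE.
Qed.

Lemma hsp0S k : hsp 0 x y k.+1 = 0.
Proof.
rewrite /hsp /= nth_rcons size_hseq ltnn eqxx big1 ?mulr0 // => i _.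
by rewrite /psp !big_geq // mulr0 addr0 mul0r.
Qed.

(** Without variables h_{k;a} is 1 at k = 0 and 0 elsewhere: the matrix is the identity for empty
    [mu], and otherwise its first row is zero. *)
Lemma bdet0 mu : boxed_part K N mu -> bdet mu 0 = (mu 0%N == 0%N)%:R.
Proof.
move=> [ni sup leK].
have entryE Q j : (j < N)%N -> det_entry (hsp 0 x y) Q j = (Q == N - j)%N%:R.
  move=> jN; have [lt_Q|gt_Q|eQ] := ltngtP Q (N - j)%N.
  - by rewrite det_entry_lt.
  - rewrite det_entry_ge ?(ltnW gt_Q) //.
    have -> : (Q - (N - j) = (Q - (N - j)).-1.+1)%N by lia.
    rewrite /hka big1_seq // => -[|i]; rewrite mem_index_iota //= => _.
    by rewrite hsp0S mulr0.
  - by rewrite eQ det_entry_ge // subnn.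
have [mu0|mu0] := eqVneq (mu 0%N) 0%N.
  have mu_0 i : mu i = 0%N by apply/eqP; rewrite -leqn0 -mu0; apply: nonincr_le.
  rewrite /bdet -[RHS](det1 F N); congr (\det _); apply/matrixP => i j.
  rewrite !mxE entryE // mu_0 add0n -val_eqE /=; congr (_%:R).
  by have := ltn_ord i; have := ltn_ord j; lia.
have N0 : (0 < N)%N by rewrite lt0n; apply: contraNneq mu0 => N0; rewrite sup ?N0.
rewrite /bdet (expand_det_row _ (Ordinal N0)) big1 // => j _.
rewrite mxE entryE //= subn0; case: eqP => [e|_]; last by rewrite mul0r.
by move: mu0 e; have := ltn_ord j; lia.
Qed.

Lemma bdet_tabsum M mu : boxed_part K N mu -> bdet mu M = tabsum K a x y mu M.
Proof.
elim: M mu => [|M IH] mu pm; first by rewrite bdet0 // (tabsum0 _ _ _ pm).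
rewrite bdetS // (tabsumS _ _ _ leNK) //; apply: eq_bigr => f df.
by rewrite IH //; apply: part_of_partn.
Qed.

End DeterminantBranching.

(** * From the determinant of the definition to beta-numbers *)

Lemma beta_index (m i j N : nat) : (i < N)%N ->
  m%:Z - i.+1%:Z + j.+1%:Z = (m + (N - i))%N%:Z - N%:Z + j%:Z.
Proof. lia. Qed.

Theorem theorem14 (R : realType) (a : int -> R[i]) (mu : seq nat)
    (n : nat) (x y : nat -> R[i]) :
  sorted geq mu -> 0%N \notin mu ->
  (forall k, (n < k)%N -> x k = 0 /\ y k = 0) ->
  forall M : nat, (n <= M)%N ->
  schur a mu (hsp M x y) =
  \sum_(T : {ffun 'I_(sumn mu) * 'I_(sumn mu) -> 'I_M.+1} | dstab mu T)
     \prod_(1 <= k < M.+1)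
        fdiag a [set b | val (T b) == k] (x k) (y k).
Proof.
(* [sumn mu] bounds the row lengths and, the parts being positive, also the number of rows. *)
move=> mu_sorted mu0 _ M _; set K := sumn mu; set N := size mu.
have le_sum (s : seq nat) i : (nth 0%N s i <= sumn s)%N.
  elim: s i => [|m s IH] [|i] //=; first exact: leq_addr.
  exact: leq_trans (IH i) (leq_addl _ _).
have leNK : (N <= K)%N.
  rewrite /N /K; elim: mu mu0 {mu_sorted N K} => //= m s IH.
  by rewrite inE negb_or eq_sym -lt0n => /andP[m0 /IH]; lia.
have pm : boxed_part K N (nth 0%N mu).
  split=> // [i|i Ni]; last by rewrite nth_default.
  have [Ni|iN] := leqP N i.+1; first by rewrite nth_default.
  by apply: (sortedP 0%N mu_sorted).
rewrite (eq_bigl (dst (nth 0%N mu) (M := M))); last by move=> T; apply: dstab_dst.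
rewrite -[RHS]/(tabsum K a x y (nth 0%N mu) M) -(@bdet_tabsum _ K N) //; last exact: pchar_num.
congr (\det _); apply/matrixP => i j; rewrite !mxE /det_entry; congr (hka _ _ _).
exact: beta_index.
Qed.
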